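(* Let $N\ge 2$ and let $T^{\pm}(u)=(t^{\pm}_{ij}(u))_{1\le i,j\le N}$ be the generating matrices of the Yangian double $\mathcal{D}Y_{\hbar}(\mathfrak{gl}_N)$. Then $T^{+}(u)$ and $T^{-}(u)$ have unique decompositions of the form $$T^{\pm}(u)=F^{\pm}(u)\,K^{\pm}_{\mathrm{diag}}(u)\,E^{\pm}(u),$$ where all entries lie in $\mathcal{D}Y_{\hbar}(\mathfrak{gl}_N)[[u^{\mp1}]]$, $F^{\pm}(u)$ is lower triangular with diagonal entries $1$ and entries $f^{\pm}_{i,j}(u)$ $(i>j)$ below the diagonal, $K^{\pm}_{\mathrm{diag}}(u)=\mathrm{diag}(k^{\pm}_1(u),\dots,k^{\pm}_N(u))$, and $E^{\pm}(u)$ is upper triangular with diagonal entries $1$ and entries $e^{\pm}_{i,j}(u)$ $(i<j)$ above the diagonal.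
   Context: Let $\mathcal{A}=\mathbb{C}[[\hbar]]$, let $V$ be a free $\mathcal{A}$-module of rank $N$, $\mathcal{P}\in\mathrm{End}(V\otimes V)$ the permutation $\mathcal{P}(v\otimes w)=w\otimes v$, and $$R(u)=\frac{1}{u+\hbar}(uI+\hbar\mathcal{P})\in\mathrm{End}(V\otimes V),$$ expanded in nonnegative powers of $\hbar$. The Yangian double $\mathcal{D}Y_{\hbar}(\mathfrak{gl}_N)$ is the topological ($\hbar$-adically complete) algebra over $\mathcal{A}$ generated by $\{t_{ij}^k\mid 1\le i,j\le N,\ k\in\mathbb{Z}\}$ and $c$; with $$t_{ij}^{+}(u)=\delta_{ij}-\hbar\sum_{k\ge0}t_{ij}^{k}u^{-k-1},\qquad t_{ij}^{-}(u)=\delta_{ij}+\hbar\sum_{k<0}t_{ij}^{k}u^{-k-1},\qquad T^{\pm}(u)=(t^{\pm}_{ij}(u)),$$ the defining relations are $$[T^{\pm}(u),c]=0,\qquad R(u-v)\overset{1}{T^{\pm}}(u)\overset{2}{T^{\pm}}(v)=\overset{2}{T^{\pm}}(v)\overset{1}{T^{\pm}}(u)R(u-v),$$ $$R(u_{-}-v_{+})\overset{1}{T^{+}}(u)\overset{2}{T^{-}}(v)=\overset{2}{T^{-}}(v)\overset{1}{T^{+}}(u)R(u_{+}-v_{-}),$$ where $\overset{1}{T}(u)=T(u)\otimes\mathrm{id}$, $\overset{2}{T}(u)=\mathrm{id}\otimes T(u)$, $u_{\pm}=u\pm\frac14\hbar c$, $v_\pm=v\pm\frac14\hbar c$; in the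 last relation, powers of $(u-v)^{-1}$ are expanded in $u^{-1}$ and $v$. *)

(* Defs.v *)
From HB Require Import structures.
From mathcomp Require Import all_boot all_order all_algebra.
From mathcomp Require Import boolp reals.
From mathcomp Require Import complex mxtens.
From mathcomp Require Import monalg.

Set Implicit Arguments.
Unset Strict Implicit.
Unset Printing Implicit Defensive.

Import GRing.Theory.
Local Open Scope ring_scope.

(* Formal power series B[[z]] in one central variable z over a possibly
   noncommutative ring B. The same type is used for C[[hbar]], for hbar-adic
   completions, for B[[u^-1]] and for B[[u]]. *)
Record fps (B : Type) := Fps { fpscoef : nat -> B }.
Notation "{ 'fps' B }" := (fps B) (at level 0, format "{ 'fps'  B }").
Notation "x .[coef n ]" := (fpscoef x n)
  (at level 2, left associativity, format "x .[coef  n ]").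

Lemma fpsP (B : Type) (x y : {fps B}) :
  (forall n, x.[coef n] = y.[coef n]) -> x = y.
Proof. by case: x y => [x] [y] /= xy; congr Fps; apply/funext. Qed.

HB.instance Definition _ (B : Type) := gen_eqMixin {fps B}.
HB.instance Definition _ (B : Type) := gen_choiceMixin {fps B}.

Section FpsZmod.
Variable B : zmodType.
Implicit Types x y z : {fps B}.

Definition fps0 : {fps B} := Fps (fun=> 0).
Definition fps_opp x : {fps B} := Fps (fun n => - x.[coef n]).
Definition fps_add x y : {fps B} := Fps (fun n => x.[coef n] + y.[coef n]).

Fact fps_addA : associative fps_add.
Proof. by move=> x y z; apply: fpsP => n /=; rewrite addrA. Qed.
Fact fps_addC : commutative fps_add.
Proof. by move=> x y; apply: fpsP => n /=; rewrite addrC. Qed.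
Fact fps_add0 : left_id fps0 fps_add.
Proof. by move=> x; apply: fpsP => n /=; rewrite add0r. Qed.
Fact fps_addN : left_inverse fps0 fps_opp fps_add.
Proof. by move=> x; apply: fpsP => n /=; rewrite addNr. Qed.

HB.instance Definition _ :=
  GRing.isZmodule.Build {fps B} fps_addA fps_addC fps_add0 fps_addN.

End FpsZmod.

Section FpsRing.
Variable B : pzRingType.
Implicit Types x y z : {fps B}.

Definition fpsC (b : B) : {fps B} := Fps (fun n => if n is 0%N then b else 0).
Definition fpsX : {fps B} := Fps (fun n => (n == 1%N)%:R).
Definition fps_mul x y : {fps B} :=
  Fps (fun n => \sum_(i < n.+1) x.[coef i] * y.[coef (n - i)]).

Fact fps_mul_rev x y n :
  (fps_mul x y).[coef n] = \sum_(i < n.+1) x.[coef (n - i)] * y.[coef i].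
Proof.
rewrite /= (reindex_inj rev_ord_inj) /=.
by apply: eq_bigr => j _; rewrite (sub_ordK j).
Qed.

Fact fps_mulA : associative fps_mul.
Proof.
move=> p q r; apply: fpsP => i; rewrite [RHS]fps_mul_rev.
pose coef3 j k := p.[coef j] * (q.[coef (i - j - k)] * r.[coef k]).
transitivity (\sum_(j < i.+1) \sum_(k < i.+1 | (k <= i - j)%N) coef3 j k).
  apply: eq_bigr => j _; rewrite [X in _ * X]fps_mul_rev big_distrr /=.
  by rewrite (big_ord_narrow_leq (leq_subr _ _)).
rewrite (exchange_big_dep predT) //=; apply: eq_bigr => k _.
transitivity (\sum_(j < i.+1 | (j <= i - k)%N) coef3 j k).
  apply: eq_bigl => j; rewrite -ltnS -(ltnS j) -!subSn ?leq_ord //.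
  by rewrite -subn_gt0 -(subn_gt0 j) -!subnDA addnC.
rewrite (big_ord_narrow_leq (leq_subr _ _)) big_distrl /=.
by apply: eq_bigr => j _; rewrite /coef3 -!subnDA addnC mulrA.
Qed.

Fact fps_mul1 : left_id (fpsC 1) fps_mul.
Proof.
move=> p; apply: fpsP => i /=.
by rewrite big_ord_recl subn0 mul1r big1 ?addr0 // => j _; rewrite /= mul0r.
Qed.

Fact fps_1mul : right_id (fpsC 1) fps_mul.
Proof.
move=> p; apply: fpsP => i; rewrite fps_mul_rev.
by rewrite big_ord_recl subn0 mulr1 big1 ?addr0 // => j _; rewrite /= mulr0.
Qed.

Fact fps_mulDl : left_distributive fps_mul +%R.
Proof.
move=> p q r; apply: fpsP => i /=; rewrite -big_split.
by apply: eq_bigr => j _; rewrite mulrDl.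
Qed.

Fact fps_mulDr : right_distributive fps_mul +%R.
Proof.
move=> p q r; apply: fpsP => i /=; rewrite -big_split.
by apply: eq_bigr => j _; rewrite mulrDr.
Qed.

HB.instance Definition _ := GRing.Zmodule_isPzRing.Build {fps B}
  fps_mulA fps_mul1 fps_1mul fps_mulDl fps_mulDr.

(* 1 / (1 - q z) *)
Definition fps_geom (q : B) : {fps B} := Fps (fun n => q ^+ n).

End FpsRing.

Arguments fpsX {B}.

Section FpsMap.
Variables (B B' : pzRingType) (f : {rmorphism B -> B'}).

Definition fps_map (x : {fps B}) : {fps B'} := Fps (fun n => f x.[coef n]).

Fact fps_map_is_zmod_morphism : zmod_morphism fps_map.
Proof. by move=> x y; apply: fpsP => n /=; rewrite rmorphB. Qed.

Fact fps_map_is_monoid_morphism : monoid_morphism fps_map.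
Proof.
split=> [|x y]; apply: fpsP => n /=.
  by case: n => [|n]; rewrite ?rmorph1 ?rmorph0.
by rewrite rmorph_sum; apply: eq_bigr => i _; rewrite rmorphM.
Qed.

HB.instance Definition _ :=
  GRing.isZmodMorphism.Build {fps B} {fps B'} fps_map fps_map_is_zmod_morphism.
HB.instance Definition _ := GRing.isMonoidMorphism.Build {fps B} {fps B'}
  fps_map fps_map_is_monoid_morphism.

End FpsMap.

(* hbar-adically complete associative algebras over K[[hbar]] presented by
   generators X and relations. *)
Section CompletePresentation.
Variables (K : comNzRingType) (X : choiceType).

(* K<X>[[hbar]] is the hbar-adic completion of the free K[[hbar]]-algebra on X;
   {malg K[{fmonom X}]} is the free associative algebra K<X>. *)
Definition cfree := {fps {malg K[{fmonom X}]}}.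
HB.instance Definition _ := GRing.PzRing.on cfree.

Definition cfree_scalar : {fps K} -> cfree :=
  fps_map (malgC : K -> {malg K[{fmonom X}]}).
HB.instance Definition _ := GRing.RMorphism.on cfree_scalar.

Definition cfree_gen (g : X) : cfree := fpsC << fmu g >>.

Definition two_sided_ideal (J : cfree -> Prop) : Prop :=
  [/\ J 0,
      forall x y, J x -> J y -> J (x - y),
      forall a x, J x -> J (a * x) &
      forall a x, J x -> J (x * a)].

(* Two series are congruent modulo hbar^n when they have the same first n
   coefficients. *)
Definition hbar_closed (J : cfree -> Prop) : Prop :=
  forall x : cfree,
    (forall n, exists2 y : cfree,
       J y & forall m, (m < n)%N -> x.[coef m] = y.[coef m]) -> J x.

Variable rel : cfree -> Prop.

(* The smallest closed two-sided ideal containing the relations. *)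
Definition rel_ideal : pred cfree := fun x =>
  `[< forall J, two_sided_ideal J -> hbar_closed J ->
        (forall r, rel r -> J r) -> J x >].

Fact rel_ideal_zmod_closed : zmod_closed rel_ideal.
Proof.
split=> [|x y]; first by apply/asboolP => J [].
move=> /asboolP Jx /asboolP Jy; apply/asboolP => J iJ cJ rJ.
by case: (iJ) => _ JB _ _; apply: JB; [apply: Jx | apply: Jy].
Qed.

HB.instance Definition _ :=
  GRing.isZmodClosed.Build cfree rel_ideal rel_ideal_zmod_closed.

Fact rel_idealMl a x : x \in rel_ideal -> a * x \in rel_ideal.
Proof.
move=> /asboolP Jx; apply/asboolP => J iJ cJ rJ.
by case: (iJ) => _ _ JM _; apply: JM; apply: Jx.
Qed.

Fact rel_idealMr a x : x \in rel_ideal -> x * a \in rel_ideal.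
Proof.
move=> /asboolP Jx; apply/asboolP => J iJ cJ rJ.
by case: (iJ) => _ _ _ JM; apply: JM; apply: Jx.
Qed.

(* A quotient of a complete algebra by a closed ideal is complete and
   separated. *)
Definition cpres := Quotient.quot (GRing.ZmodClosed.clone cfree rel_ideal _).
HB.instance Definition _ := GRing.Zmodule.on cpres.

Definition cpres_pi : cfree -> cpres := fun x => (\pi_cpres x)%qT.

Fact cpres_eqP x y : reflect (cpres_pi x = cpres_pi y) (x - y \in rel_ideal).
Proof. by rewrite Quotient.idealrBE; apply: eqP. Qed.

Fact cpres_piK : cancel (@repr _ cpres) cpres_pi.
Proof. exact: reprK. Qed.

Definition cpres_one : cpres := cpres_pi 1.
Definition cpres_mul (x y : cpres) : cpres := cpres_pi (repr x * repr y).

Fact cpres_piM x y : cpres_pi (x * y) = cpres_mul (cpres_pi x) (cpres_pi y).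
Proof.
apply/cpres_eqP; set x' := repr _; set y' := repr _.
have -> : x * y - x' * y' = x * (y - y') + (x - x') * y'.
  by rewrite mulrBr mulrBl addrA subrK.
by apply: rpredD; [apply: rel_idealMl | apply: rel_idealMr];
  apply/cpres_eqP; rewrite cpres_piK.
Qed.

Fact cpres_piB : zmod_morphism cpres_pi.
Proof. by move=> x y; rewrite /cpres_pi !piE. Qed.

Fact cpres_piD x y : cpres_pi (x + y) = cpres_pi x + cpres_pi y.
Proof. by rewrite /cpres_pi !piE. Qed.

Fact cpres_mulA : associative cpres_mul.
Proof.
by move=> x y z; rewrite -[x]cpres_piK -[y]cpres_piK -[z]cpres_piK
  -!cpres_piM mulrA.
Qed.
Fact cpres_mul1 : left_id cpres_one cpres_mul.
Proof. by move=> x; rewrite -[x]cpres_piK -cpres_piM mul1r. Qed.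
Fact cpres_1mul : right_id cpres_one cpres_mul.
Proof. by move=> x; rewrite -[x]cpres_piK -cpres_piM mulr1. Qed.
Fact cpres_mulDl : left_distributive cpres_mul +%R.
Proof.
by move=> x y z; rewrite -[x]cpres_piK -[y]cpres_piK -[z]cpres_piK
  -cpres_piD -!cpres_piM mulrDl cpres_piD.
Qed.
Fact cpres_mulDr : right_distributive cpres_mul +%R.
Proof.
by move=> x y z; rewrite -[x]cpres_piK -[y]cpres_piK -[z]cpres_piK
  -cpres_piD -!cpres_piM mulrDr cpres_piD.
Qed.

HB.instance Definition _ := GRing.Zmodule_isPzRing.Build cpres
  cpres_mulA cpres_mul1 cpres_1mul cpres_mulDl cpres_mulDr.
HB.instance Definition _ :=
  GRing.isZmodMorphism.Build cfree cpres cpres_pi cpres_piB.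
HB.instance Definition _ :=
  GRing.isMonoidMorphism.Build cfree cpres cpres_pi (erefl, cpres_piM).

(* The K[[hbar]]-algebra structure, as a ring morphism with central image. *)
Definition cpres_scalar : {fps K} -> cpres := cpres_pi \o cfree_scalar.
HB.instance Definition _ := GRing.RMorphism.on cpres_scalar.

Fact malgC_comm (c : K) (g : {malg K[{fmonom X}]}) : c%:MP * g = g * c%:MP.
Proof.
rewrite !malgM_def fgmulUg fgmulgU; apply: eq_bigr => k _.
by rewrite mul1m mulm1 mulrC.
Qed.

Fact cfree_scalarC a x : cfree_scalar a * x = x * cfree_scalar a.
Proof.
apply: fpsP => n; rewrite [RHS]fps_mul_rev.
by apply: eq_bigr => i _ /=; rewrite malgC_comm.
Qed.

Fact cpres_scalarC a x : cpres_scalar a * x = x * cpres_scalar a.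
Proof.
rewrite -[x]cpres_piK /cpres_scalar /=.
by rewrite -!(rmorphM cpres_pi) cfree_scalarC.
Qed.

Definition cpres_gen (g : X) : cpres := cpres_pi (cfree_gen g).

End CompletePresentation.

Section YangianDouble.
Variables (R : realType) (N : nat).

Let C := R[i].

(* Some (i, j, k) is t_ij^k and None is c. *)
Definition yd_gen : Type := option ('I_N * 'I_N * int).
HB.instance Definition _ := Choice.on yd_gen.

(* T^+(u), as a series in u^-1, and T^-(u), as a series in u. Both are defined
   for an arbitrary ring B, element h (= hbar) and family t, since they are
   needed in the free algebra, to write the relations, and in the quotient. *)
Section T.
Variables (B : pzRingType) (h : B) (t : 'I_N -> 'I_N -> int -> B).

Definition Tplus : 'M[{fps B}]_N := \matrix_(i, j)
  (fpsC (i == j)%:R - Fps (fun m => if m is k.+1 then h * t i j k%:Z else 0)).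

(* Negz m is - (m + 1). *)
Definition Tminus : 'M[{fps B}]_N := \matrix_(i, j)
  (fpsC (i == j)%:R + Fps (fun m => h * t i j (Negz m))).

(* The coefficient of u^a in T^+(u) (s = true), in T^-(u) (s = false). *)
Definition Tmode (s : bool) (a : int) : 'M[B]_N :=
  if s then \matrix_(i, j) (if a <= 0 then (Tplus i j).[coef `|a|%N] else 0)
  else \matrix_(i, j) (if 0 <= a then (Tminus i j).[coef `|a|%N] else 0).

End T.

Local Notation F := (cfree C yd_gen).
Local Notation End2 := 'M[F]_(N * N).

Let hbar : F := cfree_scalar yd_gen fpsX.
Let t (i j : 'I_N) (k : int) : F := cfree_gen C (Some (i, j, k) : yd_gen).
Let c : F := cfree_gen C (None : yd_gen).
Let T := Tmode hbar t.

(* P (v (x) w) = w (x) v; matrices act on column vectors and tensmx is the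
   Kronecker product. *)
Definition perm2 : End2 := \matrix_(p, q)
  (((mxtens_unindex p).1 == (mxtens_unindex q).2) &&
   ((mxtens_unindex p).2 == (mxtens_unindex q).1))%:R.

(* An End(V (x) V)-valued formal series in u and v, given by its coefficient
   of u^a v^b. *)
Definition series2 := int -> int -> End2.

(* T^1(u) T^2(v) and T^2(v) T^1(u), for T^{s1}(u) and T^{s2}(v). *)
Definition T1T2 (s1 s2 : bool) : series2 := fun a b =>
  tensmx (T s1 a) 1%:M *m tensmx 1%:M (T s2 b).
Definition T2T1 (s1 s2 : bool) : series2 := fun a b =>
  tensmx 1%:M (T s2 b) *m tensmx (T s1 a) 1%:M.

(* Multiplication by (u - v)^-1 = \sum_(k >= 0) u^(-k-1) v^k. In all the series
   to which it is applied, either only powers u^p with p <= 0 or only powers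
   v^q with q >= 0 occur, hence the terms with k > |a| + |b| vanish; this
   support condition is preserved. For two series T^+ or two series T^- the
   direction of the expansion is immaterial, the relation being equivalent to
   the one cleared of the denominator u - v + hbar. *)
Definition divuv (A : series2) : series2 := fun a b =>
  \sum_(k < (`|a| + `|b|).+1) A (a + 1 + k%:Z) (b - k%:Z).

(* R(u - v + hbar g) as a power series in z = (u - v)^-1: since
   x = (u - v) (1 + hbar g z), the factor u - v cancels in
   (x + hbar)^-1 (x I + hbar P). Its coefficient of z^n is divisible by
   hbar^n. *)
Definition Rseries (g : F) : {fps End2} :=
  fps_geom (- (hbar * (g + 1))%:M) *
  (1 + fpsC (hbar * g)%:M * fpsX + fpsC (hbar%:M *m perm2) * fpsX).

(* \sum_n x n for a family such that hbar^n divides x n. *)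
Definition hbar_sum (x : nat -> End2) : End2 := \matrix_(p, q)
  (Fps (fun m => \sum_(n < m.+1) (x n p q).[coef m]) : F).

Definition Rmull (r : {fps End2}) (A : series2) : series2 := fun a b =>
  hbar_sum (fun n => r.[coef n] *m iter n divuv A a b).
Definition Rmulr (A : series2) (r : {fps End2}) : series2 := fun a b =>
  hbar_sum (fun n => iter n divuv A a b *m r.[coef n]).

(* u_{+-} = u +- hbar c / 4, v_{+-} = v +- hbar c / 4. *)
Let c4 : F := cfree_scalar yd_gen (fpsC (4%:R^-1)) * c.

Inductive yd_rel : F -> Prop :=
| yd_rel_central s a i j :
    yd_rel (T s a i j * c - c * T s a i j)
| yd_rel_RTT s a b p q :
    yd_rel ((Rmull (Rseries 0) (T1T2 s s) a b
             - Rmulr (T2T1 s s) (Rseries 0) a b) p q)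
| yd_rel_RTTpm a b p q :
    (* u_- - v_+ = u - v + hbar (- c/4 - c/4),
       u_+ - v_- = u - v + hbar (c/4 + c/4) *)
    yd_rel ((Rmull (Rseries (- c4 - c4)) (T1T2 true false) a b
             - Rmulr (T2T1 true false) (Rseries (c4 + c4)) a b) p q).

Definition DY := cpres yd_rel.
HB.instance Definition _ := GRing.PzRing.on DY.

Definition DY_hbar : DY := cpres_scalar yd_rel fpsX.
Definition DY_t (i j : 'I_N) (k : int) : DY := cpres_gen yd_rel (Some (i, j, k)).

(* The variable of {fps DY} is u^-1 in DY_Tplus and u in DY_Tminus. *)
Definition DY_Tplus : 'M[{fps DY}]_N := Tplus DY_hbar DY_t.
Definition DY_Tminus : 'M[{fps DY}]_N := Tminus DY_hbar DY_t.

End YangianDouble.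

(* d = (F, k, E) with T = F diag(k) E; is_trig_mx means lower triangular. *)
Definition gauss_decomposition (B : pzRingType) (n : nat) (T : 'M[B]_n)
    (d : 'M[B]_n * 'rV[B]_n * 'M[B]_n) : Prop :=
  let: (F, k, E) := d in
  [/\ is_trig_mx F /\ (forall i, F i i = 1),
      is_trig_mx E^T /\ (forall i, E i i = 1) &
      T = F *m diag_mx k *m E].

(* Main.v *)
Require Import Defs.
From mathcomp Require Import all_boot all_order all_algebra.
From mathcomp Require Import reals monalg.

(* Since T^+(u) = 1 + O(u^-1) and T^-(u) = 1 + hbar (...), both matrices are
   congruent to the identity modulo the ideal of the series whose constant
   coefficient is divisible by hbar, and 1 + x is invertible for x in this
   ideal by completeness. This congruence passes to the Schur complement of
   the upper left entry, so one step of Gaussian elimination, each factor being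
   forced because the pivot is invertible, gives existence and uniqueness by
   induction on the size. *)

Set Implicit Arguments.
Unset Strict Implicit.
Unset Printing Implicit Defensive.

Import GRing.Theory.
Local Open Scope ring_scope.

Definition has_inverse (B : pzRingType) (x : B) : Prop :=
  exists y, y * x = 1 /\ x * y = 1.

Lemma has_inverse_rmorph (B B' : pzRingType) (f : {rmorphism B -> B'}) x :
  has_inverse x -> has_inverse (f x).
Proof. by move=> [y [yx xy]]; exists (f y); rewrite -!rmorphM yx xy rmorph1. Qed.

Section FpsInverse.
Variable B : pzRingType.
Implicit Types q x : {fps B}.

Lemma fpscoef_sum (I : Type) (r : seq I) (F : I -> {fps B}) n :
  (\sum_(i <- r) F i).[coef n] = \sum_(i <- r) (F i).[coef n].
Proof. by elim/big_rec2: _ => //= i y1 y2 _ ->. Qed.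

Lemma fpscoef0M x y : (x * y).[coef 0] = x.[coef 0] * y.[coef 0].
Proof. by rewrite /= big_ord1. Qed.

Lemma fpscoefX_eq0 q k n : q.[coef 0] = 0 -> (n < k)%N -> (q ^+ k).[coef n] = 0.
Proof.
move=> q0; elim: k n => // k IH n lt_nk; rewrite exprS [LHS]/=.
apply: big1 => -[[|i] lt_i] _ /=; first by rewrite q0 mul0r.
by rewrite IH ?mulr0 //; rewrite !ltnS in lt_nk lt_i *;
  case: n lt_nk lt_i => // n lt_nk lt_i;
  rewrite subSS (leq_ltn_trans (leq_subr _ _)).
Qed.

(** The inverse is the geometric series: [q ^+ k] starts in degree [k], so the coefficient of degree
    [n] is already that of the partial sum [G n.+1], and telescoping holds up to any degree. *)
Lemma fps_inverse_sub1 q : q.[coef 0] = 0 -> has_inverse (1 - q).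
Proof.
move=> q0; pose G m := \sum_(k < m) q ^+ k.
pose y : {fps B} := Fps (fun n => (G n.+1).[coef n]).
have yG m n : (n < m)%N -> y.[coef n] = (G m).[coef n].
  move=> lt_nm; rewrite /y /G /= !fpscoef_sum (big_ord_widen m
    (fun k => (q ^+ k).[coef n])) // big_mkcond; apply: eq_bigr => k _.
  by case: (ltnP k n.+1) => // lt_nk; rewrite fpscoefX_eq0.
have one_q m n : (n < m)%N -> (1 - q ^+ m).[coef n] = (1 : {fps B}).[coef n].
  by move=> lt_nm; rewrite [LHS]/= fpscoefX_eq0 // subr0.
have qG m : (1 - q) * G m = 1 - q ^+ m.
  by apply: oppr_inj; rewrite opprB subrX1 -mulNr opprB.
have Gq m : G m * (1 - q) = 1 - q ^+ m.
  rewrite -qG; apply/commr_sym/commr_sum => k _.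
  by apply: commrX; apply/commr_sym/commrB => //; apply: commr1.
exists y; split; apply: fpsP => n.
  rewrite -(one_q n.+1) // -Gq /=; apply: eq_bigr => i _.
  by congr (_ * _); apply: (yG n.+1).
rewrite -(one_q n.+1) // -qG /=; apply: eq_bigr => i _.
by congr (_ * _); apply: (yG n.+1); rewrite ltnS leq_subr.
Qed.

(** Multiplying by [b] on either side makes the constant coefficient 1. This gives a left and a
    right inverse of [x], which agree by associativity. *)
Lemma fps_inverse x : has_inverse x.[coef 0] -> has_inverse x.
Proof.
move=> [b [bx xb]].
have inv1 (z : {fps B}) : z.[coef 0] = 1 -> has_inverse z.
  move=> z0; have -> : z = 1 - (1 - z) by rewrite opprB addrC subrK.
  by apply: fps_inverse_sub1; rewrite /= z0 subrr.
have [y [yx _]] : has_inverse (fpsC b * x) by apply: inv1; rewrite fpscoef0M.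
have [z [_ xz]] : has_inverse (x * fpsC b) by apply: inv1; rewrite fpscoef0M.
rewrite mulrA in yx; rewrite -mulrA in xz.
have yz : y * fpsC b = fpsC b * z by rewrite -[LHS]mulr1 -xz mulrA yx mul1r.
by exists (y * fpsC b); split=> //; rewrite yz.
Qed.

End FpsInverse.

Section Gauss.
Variable B : pzRingType.

Definition unitrig n (F : 'M[B]_n) : Prop :=
  is_trig_mx F /\ forall i, F i i = 1.

(** Phrasing the condition on [E] through [E^T] lets the lemmas on lower unitriangular matrices
    serve both outer factors. *)
Lemma gauss_decompositionE n (T : 'M[B]_n) F k E :
  gauss_decomposition T (F, k, E) <->
  [/\ unitrig F, unitrig E^T & T = F *m diag_mx k *m E].
Proof.
rewrite /gauss_decomposition /unitrig; split=> -[uF [tE dE] ->]; split=> //;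
  by split=> // i; move: (dE i); rewrite ?mxE.
Qed.

Lemma unitrig_block n (c : 'cV[B]_n) (F : 'M_n) :
  unitrig (block_mx 1%:M 0 c F) <-> unitrig F.
Proof.
rewrite /unitrig is_trig_block_mx // eqxx mx11_is_trig /=.
split=> -[tF dF]; split=> // i; first by rewrite -(dF (rshift 1 i)) block_mxEdr.
case: (split_ordP i) => j ->; first by rewrite block_mxEul ord1 mxE eqxx.
by rewrite block_mxEdr.
Qed.

Lemma unitrig_block_eq n (F : 'M[B]_(1 + n)) :
  unitrig F -> F = block_mx 1%:M 0 (dlsubmx F) (drsubmx F).
Proof.
rewrite /unitrig -{1 3}[F]submxK is_trig_block_mx //.
move=> -[/and3P[/eqP-> _ _] dF]; congr block_mx; apply/rowP => i.
by rewrite !ord1 !mxE eqxx -[RHS](dF (lshift n 0)).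
Qed.

(** When [a] is invertible, the first row and column of the product determine [e] and [f], and the
    last block is an equation for the Schur complement. *)
Lemma block_gauss_mul n (a : 'M[B]_1) (f : 'cV_n) (e : 'rV_n)
    (F : 'M_n) (k : 'rV_n) (E : 'M_n) :
  block_mx 1%:M 0 f F *m diag_mx (row_mx a k) *m block_mx 1%:M e 0 E =
  block_mx a (a *m e) (f *m a) (f *m a *m e + F *m diag_mx k *m E).
Proof.
have da : diag_mx a = a by apply/matrixP => i j; rewrite !ord1 !mxE eqxx.
rewrite diag_mx_row !mulmx_block da.
by rewrite !(mul1mx, mul0mx, mulmx0, mulmx1, addr0, add0r).
Qed.

Lemma gauss_decomposition_block n (a a' : 'M[B]_1) b c (D : 'M_n) :
  a' *m a = 1%:M -> a *m a' = 1%:M ->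
  (exists! d, gauss_decomposition (D - c *m a' *m b) d) ->
  exists! d, gauss_decomposition (block_mx a b c D : 'M_(1 + n)) d.
Proof.
move=> a'a aa' [[[F k] E] [/gauss_decompositionE[uF uE defS] uniq]].
exists (block_mx 1%:M 0 (c *m a') F, row_mx a k, block_mx 1%:M (a' *m b) 0 E).
split.
  apply/gauss_decompositionE; rewrite tr_block_mx trmx1 trmx0.
  split; [exact/unitrig_block | exact/unitrig_block |].
  rewrite block_gauss_mul -defS mulmxA aa' mul1mx -(mulmxA c a' a) a'a mulmx1.
  by rewrite mulmxA addrC subrK.
move=> [[F1 k1] E1] /gauss_decompositionE[uF1 uE1].
have defF1 := unitrig_block_eq uF1.
have defE1 : E1 = block_mx 1%:M (ursubmx E1) 0 (drsubmx E1).
  apply: trmx_inj; rewrite [LHS](unitrig_block_eq uE1) tr_block_mx trmx1 trmx0.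
  by rewrite trmx_ursub trmx_drsub.
move: uF1 uE1; rewrite defF1 defE1 -[k1]hsubmxK tr_block_mx trmx1 trmx0.
move: (dlsubmx F1) (drsubmx F1) (lsubmx k1) (rsubmx k1).
move: (ursubmx E1) (drsubmx E1).
move=> e E2 f F2 a2 k2 /unitrig_block uF2 /unitrig_block uE2.
(* Comparing blocks yields the same pivot, [a *m e = b] and [f *m a = c]. *)
rewrite block_gauss_mul => /eq_block_mx[eq_a eq_b eq_c eq_D].
rewrite -{a2}eq_a in eq_b eq_c eq_D *.
have -> : f = c *m a' by rewrite eq_c -mulmxA aa' mulmx1.
have -> : e = a' *m b by rewrite eq_b mulmxA a'a mul1mx.
have [-> -> ->] // : (F, k, E) = (F2, k2, E2).
(* Here [c *m a' *m b] equals [f *m a *m e], so the remaining blocks decompose the Schur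
   complement. *)
apply: uniq; apply/gauss_decompositionE; split=> //.
rewrite eq_D eq_b eq_c -[f *m a *m a']mulmxA aa' mulmx1 -(mulmxA f a e).
by rewrite addrAC subrr add0r.
Qed.

(** The Schur complement stays congruent to the identity: its correction term begins with an
    off-diagonal entry of [T], which lies in [J], and [J] absorbs right multiplication. *)
Lemma gauss_decomposition_cong1 (J : B -> Prop) :
  (forall x y, J x -> J y -> J (x - y)) ->
  (forall x y, J x -> J (x * y)) ->
  (forall x, J x -> has_inverse (1 + x)) ->
  forall n (T : 'M[B]_n), (forall i j, J (T i j - (i == j)%:R)) ->
  exists! d, gauss_decomposition T d.
Proof.
move=> JB JM Jinv; elim=> [|n IH] T JT.
  exists (0, 0, 0); split.
    split; try by split=> [|[]//]; apply/is_trig_mxP => -[].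
    by apply/matrixP => -[].
  by move=> [[F k] E] _; rewrite (flatmx0 F) (flatmx0 E) (thinmx0 k).
have [y [y_a a_y]] : has_inverse (T 0 0).
  by have := Jinv _ (JT 0 0); rewrite eqxx addrC subrK.
have defa : ulsubmx (T : 'M_(1 + n)) = (T 0 0)%:M.
  by apply/matrixP => i j; rewrite !ord1 !mxE eqxx; congr (T _ _);
    apply: val_inj.
rewrite -[T](@submxK _ 1 n 1 n) defa.
apply: (@gauss_decomposition_block _ _ y%:M); rewrite -?scalar_mxM ?y_a ?a_y //.
apply: IH => i j.
rewrite !mxE big_ord1 !mxE big_ord1 !mxE addrAC -mulrA.
apply: JB; first by rewrite -(eq_rshift 1); apply: JT.
(* The entry is off-diagonal, so subtracting the vanishing Kronecker delta brings it to the form of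
   [JT]. *)
apply: JM; rewrite -[X in J X]subr0 -[0](_ : (rshift 1 i == lshift n 0)%:R = 0).
  exact: JT.
by rewrite eq_rlshift.
Qed.

End Gauss.

Section GaussFps.
Variables (B : pzRingType) (h : B).
Local Notation inv1D := (forall x, has_inverse (1 + h * x)).

(** [J] consists of the series with constant coefficient in [h * B], which is stable under right
    multiplication even if [h] is not central. *)
Lemma gauss_decomposition_fps n (T : 'M[{fps B}]_n) :
  inv1D -> (forall i j, exists x, (T i j).[coef 0] = (i == j)%:R + h * x) ->
  exists! d, gauss_decomposition T d.
Proof.
move=> h_inv T1; pose J (z : {fps B}) := exists x, z.[coef 0] = h * x.
apply: (@gauss_decomposition_cong1 _ J).
- by move=> z w [x zx] [y wy]; exists (x - y); rewrite mulrBr -zx -wy.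
- by move=> z w [x zx]; exists (x * w.[coef 0]); rewrite fpscoef0M zx mulrA.
- by move=> z [x zx]; apply: fps_inverse; rewrite /= zx; apply: h_inv.
move=> i j; have [x Tx] := T1 i j; exists x.
have -> : (T i j - (i == j)%:R).[coef 0] = (T i j).[coef 0] - (i == j)%:R.
  by case: (i == j).
by rewrite Tx addrAC subrr add0r.
Qed.

Lemma gauss_decomposition_Tplus n (t : 'I_n -> 'I_n -> int -> B) :
  inv1D -> exists! d, gauss_decomposition (Tplus h t) d.
Proof.
move=> h_inv; apply: gauss_decomposition_fps => // i j.
(* The subtracted series starts at the first power of the variable. *)
by exists 0; rewrite mxE mulr0 addr0 /= subr0.
Qed.

Lemma gauss_decomposition_Tminus n (t : 'I_n -> 'I_n -> int -> B) :
  inv1D -> exists! d, gauss_decomposition (Tminus h t) d.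
Proof.
move=> h_inv; apply: gauss_decomposition_fps => // i j.
(* [Negz 0] is -1, the mode in the constant term in [u]. *)
by exists (t i j (Negz 0)); rewrite mxE.
Qed.

End GaussFps.

(** Completeness enters here: a lift of [x] lives in genuine power series in [hbar], where the
    constant coefficient of the lifted element is 1; the quotient morphism then carries the inverse
    down. *)
Lemma cpres_has_inverse_1Dhbar (K : comNzRingType) (X : choiceType)
    (rel : cfree K X -> Prop) (x : cpres rel) :
  has_inverse (1 + cpres_scalar rel fpsX * x).
Proof.
have inv_z (z : cfree K X) : has_inverse (1 + cfree_scalar X fpsX * z).
  apply: (fps_inverse (B := {malg K[{fmonom X}]})); exists 1.
  by rewrite /= big_ord1 /= rmorph0 mul0r addr0 mulr1.
rewrite -[x]cpres_piK.
have := has_inverse_rmorph (cpres_pi rel) (inv_z (repr x)).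
by rewrite rmorphD rmorph1 rmorphM.
Qed.

Theorem theorem3p2 (R : realType) (N : nat) (N_ge2 : (2 <= N)%N) :
  (exists! FKE : 'M[{fps DY R N}]_N * 'rV[{fps DY R N}]_N * 'M[{fps DY R N}]_N,
     gauss_decomposition (DY_Tplus R N) FKE) /\
  (exists! FKE : 'M[{fps DY R N}]_N * 'rV[{fps DY R N}]_N * 'M[{fps DY R N}]_N,
     gauss_decomposition (DY_Tminus R N) FKE).
Proof.
split.
  exact: (gauss_decomposition_Tplus _ (@cpres_has_inverse_1Dhbar _ _ _)).
exact: (gauss_decomposition_Tminus _ (@cpres_has_inverse_1Dhbar _ _ _)).
Qed.
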